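(* Let $\mathcal{K}\hookrightarrow\mathcal{L}$ be an inclusion of finite simplicial complexes. Then the $q$-th persistent up Laplacian coincides with the Dirichlet-to-Neumann map on $q$-chains; that is, $$\Lambda=\Delta_{q,\mathrm{up}}^{\mathcal{K},\mathcal{L}}.$$
   Context: $S_q^{\mathcal{X}}$ is the set of $q$-simplices of $\mathcal{X}$ and $C_q^{\mathcal{X}}$ the real $q$-chains with the inner product making oriented $q$-simplices orthonormal. $\Delta_{q,\mathrm{up}}^{\mathcal{L}}=\partial_{q+1}^{\mathcal{L}}(\partial_{q+1}^{\mathcal{L}})^*$ is the up Laplacian on $C_q^{\mathcal{L}}$. Let $C_{q+1}^{\mathcal{L},\mathcal{K}}=\{c\in C_{q+1}^{\mathcal{L}}:\partial_{q+1}^{\mathcal{L}}c\in C_q^{\mathcal{K}}\}$ with the restricted inner product, $\partial_{q+1}^{\mathcal{L},\mathcal{K}}:C_{q+1}^{\mathcal{L},\mathcal{K}}\to C_q^{\mathcal{K}}$ the restriction of $\partial_{q+1}^{\mathcal{L}}$, and $\Delta_{q,\mathrm{up}}^{\mathcal{K},\mathcal{L}}=\partial_{q+1}^{\mathcal{L},\mathcal{K}}(\partial_{q+1}^{\mathcal{L},\mathcal{K}})^*$. Write $\mathcal{B}=S_q^{\mathcal{K}}$ and $\mathcal{I}=S_q^{\mathcal{L}}\setminus S_q^{\mathcal{K}}$; a chain $u$ is regarded as its function of coefficients $u(\sigma)$. The Dirichlet-to-Neumann map is $$\Lambda:C_q^{\mathcal{K}}\to C_q^{\mathcal{K}},\qquad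 u_{\mathcal{B}}\mapsto(\Delta_{q,\mathrm{up}}^{\mathcal{L}}u)|_{\mathcal{B}},$$ where $u\in C_q^{\mathcal{L}}$ is a solution of $(\Delta_{q,\mathrm{up}}^{\mathcal{L}}u)(\sigma)=0$ for $\sigma\in\mathcal{I}$ and $u(\sigma)=u_{\mathcal{B}}(\sigma)$ for $\sigma\in\mathcal{B}$. (That a solution exists and that the value $\Lambda u_{\mathcal{B}}$ does not depend on the solution chosen is part of the assertion.) *)

(* Defs.v *)
From HB Require Import structures.
From mathcomp Require Import all_boot all_order all_algebra.
From mathcomp Require classical_sets.

Set Implicit Arguments.
Unset Strict Implicit.
Unset Printing Implicit Defensive.

Import Order.TTheory GRing.Theory Num.Theory.
Local Open Scope ring_scope.

Section Adjoint.
Variables (R : realFieldType) (U W : vectType R).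

(* The adjoint of f for the scalar products dU and dW; adjointP below shows that
   it exists, so that the default value 0 of xget is never used. *)
Definition adjoint (dU : U -> U -> R) (dW : W -> W -> R) (f : 'Hom(U, W)) :
    'Hom(W, U) :=
  classical_sets.xget 0
    (fun g : 'Hom(W, U) => forall x y, dW (f x) y = dU x (g y)).

Lemma adjointP (dU : U -> U -> R) (dW : W -> W -> R) (f : 'Hom(U, W)) :
  (forall y, scalar (dU^~ y)) -> (forall x y, dU x y = dU y x) ->
  (forall x, dU x x = 0 -> x = 0) -> (forall x, scalar (dW x)) ->
  (forall y, scalar (dW^~ y)) ->
  forall x y, dW (f x) y = dU x (adjoint dU dW f y).
Proof.
move=> dUl dUC dU0 dWr dWl; rewrite /adjoint.
set P := (P in classical_sets.xget _ P);
  suff /classical_sets.xgetPex : exists g, P g by apply.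
pose e := vbasis {:U}.
pose G0 (x : U) : {ffun 'I_(\dim {:U}) -> R^o} :=
  [ffun i : 'I_(\dim {:U}) => dU x e`_i].
pose H0 (y : W) : {ffun 'I_(\dim {:U}) -> R^o} :=
  [ffun i : 'I_(\dim {:U}) => dW (f e`_i) y].
have G0lin : linear G0 by move=> a x y; apply/ffunP => i; rewrite !ffunE dUl.
have H0lin : linear H0 by move=> a x y; apply/ffunP => i; rewrite !ffunE dWr.
pose G0L := GRing.isLinear.Build _ _ _ _ G0 G0lin.
pose H0L := GRing.isLinear.Build _ _ _ _ H0 H0lin.
pose GL : {linear U -> {ffun 'I_(\dim {:U}) -> R^o}} := HB.pack G0 G0L.
pose HL : {linear W -> {ffun 'I_(\dim {:U}) -> R^o}} := HB.pack H0 H0L.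
pose G := linfun GL; pose H := linfun HL.
have scalar_sum (h : U -> R) : scalar h ->
    forall (c : 'I_(\dim {:U}) -> R),
    h (\sum_i c i *: e`_i) = \sum_i c i * h e`_i.
  move=> hl c.
  pose hL := GRing.isLinear.Build _ _ _ _ h hl.
  pose h' : {scalar U} := HB.pack h hL.
  rewrite -[h]/(h' : U -> R) linear_sum; apply: eq_bigr => i _.
  by rewrite linearZ.
have eU (x : U) : x = \sum_i coord e i x *: e`_i.
  by apply: coord_vbasis; rewrite memvf.
have kerG : lker G == 0%VS.
  rewrite -subv0; apply/subvP => x; rewrite memv_ker lfunE /= memv0 => /eqP Gx.
  apply/eqP/dU0; rewrite {1}(eU x) (scalar_sum _ (dUl x)).
  apply: big1 => i _; rewrite dUC.
  by move/ffunP/(_ i): Gx; rewrite !ffunE => ->; rewrite mulr0.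
have imG : limg G = fullv.
  apply/eqP; rewrite eqEdim subvf /= limg_dim_eq; last first.
    by rewrite (eqP kerG) capv0.
  by rewrite (dimvf {ffun 'I_(\dim {:U}) -> R^o}) /dim /= card_ord muln1.
exists (G^-1 \o H)%VF => x y; rewrite comp_lfunE.
have GK : G (G^-1%VF (H y)) = H y by rewrite limg_lfunVK // imG memvf.
set z := (G^-1%VF (H y)) in GK *.
rewrite (eU x) (scalar_sum (dU^~ z) (dUl z)).
rewrite (scalar_sum (fun x => dW (f x) y)); last first.
  by move=> a u v; rewrite linearP dWl.
apply: eq_bigr => i _; congr (_ * _).
by move/ffunP/(_ i): GK; rewrite !lfunE /= !ffunE dUC => ->.
Qed.

End Adjoint.

Section Simplicial.
Variable V : finType.
Implicit Types K L : {set {set V}}.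

Definition simplicial_complex K : Prop :=
  set0 \notin K /\
  (forall s t : {set V}, s \in K -> t \subset s -> t != set0 -> t \in K).

Definition simplex K (q : nat) : finType :=
  {s : {set V} | (s \in K) && (#|s| == q.+1)}.

Variable R : realFieldType.

Definition chain K (q : nat) : vectType R := {ffun simplex K q -> R^o}.

Definition dotc K q (u v : chain K q) : R := \sum_s u s * v s.

(* The coefficient of u on an arbitrary set of vertices (0 if it is not a
   q-simplex of K). *)
Definition coef K q (u : chain K q) (s : {set V}) : R :=
  oapp u 0 (insub s : option (simplex K q)).

(* For K \subset L, transfer K L is the inclusion (extension by zero) of the
   chains of K into those of L, and transfer L K restricts chains of L to the
   q-simplices of K. *)
Definition transfer_fun K L q (u : chain K q) : chain L q :=
  [ffun s => coef u (val s)].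

Definition transfer K L q : 'Hom(chain K q, chain L q) :=
  linfun (@transfer_fun K L q).

(* The basis chains are the simplices with an arbitrary orientation, encoded by
   o : {set V} -> bool: o s = false if s is oriented by the order in which enum s
   lists its vertices, and o s = true if it has the opposite orientation. *)
Variable o : {set V} -> bool.

(* The simplex [v_0, ..., v_q] where enum s = [:: v_0; ...; v_q]. *)
Definition enum_simplex K q (s : {set V}) : chain K q :=
  [ffun t => if val t == s then (-1) ^+ o s else 0].

(* \sum_i (-1)^i [v_0, ..., v_(i-1), v_(i+1), ..., v_(q+1)] *)
Definition enum_boundary K q (s : {set V}) : chain K q :=
  \sum_(v in s) (-1) ^+ index v (enum s) *: enum_simplex K q (s :\ v).

Definition boundary_fun K q (c : chain K q.+1) : chain K q :=
  \sum_s (c s * (-1) ^+ o (val s)) *: enum_boundary K q (val s).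

Definition boundary K q : 'Hom(chain K q.+1, chain K q) :=
  linfun (@boundary_fun K q).

Definition up_laplacian L q : 'End(chain L q) :=
  (boundary L q \o adjoint (@dotc L q.+1) (@dotc L q) (boundary L q))%VF.

(* C_{q+1}^{L,K}: the (q+1)-chains of L whose boundary is a chain of K. *)
Definition rel_chain K L q : {vspace chain L q.+1} :=
  (boundary L q @^-1: limg (transfer K L q))%VS.

Definition dot_rel K L q (c d : subvs_of (rel_chain K L q)) : R :=
  dotc (vsval c) (vsval d).

Definition rel_boundary K L q : 'Hom(subvs_of (rel_chain K L q), chain K q) :=
  (transfer L K q \o boundary L q \o linfun vsval)%VF.

Definition persistent_up_laplacian K L q : 'End(chain K q) :=
  (rel_boundary K L q
     \o adjoint (@dot_rel K L q) (@dotc K q) (rel_boundary K L q))%VF.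

Definition dirichlet_solution K L q (uB : chain K q) (u : chain L q) : Prop :=
  (forall s : simplex L q, val s \notin K -> up_laplacian L q u s = 0) /\
  (forall s : simplex L q, val s \in K -> u s = coef uB (val s)).

(* The value at one chosen solution; that a solution exists and that the value
   does not depend on it has to be proved. *)
Definition dirichlet_to_neumann K L q (uB : chain K q) : chain K q :=
  transfer L K q
    (up_laplacian L q (classical_sets.xget 0 (dirichlet_solution uB))).

Lemma coef_val K q (u : chain K q) s : coef u (val s) = u s.
Proof. by rewrite /coef valK. Qed.

Lemma coefP K q a (u v : chain K q) s :
  coef (a *: u + v) s = a * coef u s + coef v s.
Proof. by rewrite /coef; case: insub => [t|] /=; rewrite ?ffunE ?mulr0 ?addr0. Qed.

Lemma transfer_fun_linear K L q : linear (@transfer_fun K L q).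
Proof. by move=> a u v; apply/ffunP => s; rewrite !ffunE coefP. Qed.

HB.instance Definition _ K L q :=
  GRing.isLinear.Build R (chain K q) (chain L q) *:%R (@transfer_fun K L q)
    (@transfer_fun_linear K L q).

Lemma transferE K L q (u : chain K q) s : transfer K L q u s = coef u (val s).
Proof. by rewrite lfunE ffunE. Qed.

Lemma boundary_fun_linear K q : linear (@boundary_fun K q).
Proof.
move=> a u v; rewrite /boundary_fun scaler_sumr -big_split /=.
apply: eq_bigr => s _; rewrite scalerA -scalerDl; congr (_ *: _).
by rewrite !ffunE mulrDl mulrA.
Qed.

HB.instance Definition _ K q :=
  GRing.isLinear.Build R (chain K q.+1) (chain K q) *:%R (@boundary_fun K q)
    (@boundary_fun_linear K q).

Lemma boundaryE K q (c : chain K q.+1) :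
  boundary K q c =
  \sum_s (c s * (-1) ^+ o (val s)) *: enum_boundary K q (val s).
Proof. by rewrite lfunE. Qed.

Lemma dotcC K q (u v : chain K q) : dotc u v = dotc v u.
Proof. by apply: eq_bigr => s _; rewrite mulrC. Qed.

Lemma dotc_scalar K q (v : chain K q) : scalar ((@dotc K q)^~ v).
Proof.
move=> a u w; rewrite /dotc mulr_sumr -big_split /=.
by apply: eq_bigr => s _; rewrite !ffunE mulrDl mulrA.
Qed.

Lemma dotc_eq0 K q (u : chain K q) : dotc u u = 0 -> u = 0.
Proof.
move/eqP; rewrite psumr_eq0 => [/allP u0|s _]; last by rewrite -expr2 sqr_ge0.
apply/ffunP => s; rewrite ffunE; apply/eqP.
by have := u0 s (mem_index_enum s); rewrite /= mulf_eq0 orbb.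
Qed.

Lemma dotc_scalarr K q (u : chain K q) : scalar (@dotc K q u).
Proof. by move=> a v w; rewrite ![dotc u _]dotcC dotc_scalar. Qed.

Lemma adjoint_boundaryP K q (c : chain K q.+1) (u : chain K q) :
  dotc (boundary K q c) u =
  dotc c (adjoint (@dotc K q.+1) (@dotc K q) (boundary K q) u).
Proof.
apply: adjointP; [exact: dotc_scalar | exact: dotcC | exact: dotc_eq0
  | exact: dotc_scalarr | exact: dotc_scalar].
Qed.

Lemma adjoint_rel_boundaryP K L q (c : subvs_of (rel_chain K L q))
    (u : chain K q) :
  dotc (rel_boundary K L q c) u =
  dot_rel c (adjoint (@dot_rel K L q) (@dotc K q) (rel_boundary K L q) u).
Proof.
apply: adjointP; [ | | | exact: dotc_scalarr | exact: dotc_scalar].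
- by move=> y a x z; rewrite /dot_rel linearP dotc_scalar.
- by move=> x y; apply: dotcC.
- by move=> x /dotc_eq0 x0; apply: subvs_inj; rewrite x0 linear0.
Qed.

Lemma rel_boundaryE K L q (c : subvs_of (rel_chain K L q)) :
  rel_boundary K L q c = transfer L K q (boundary L q (vsval c)).
Proof. by rewrite !comp_lfunE; do 2 congr (fun_of_lfun _ _); rewrite lfunE. Qed.

Lemma transferK K L q :
  K \subset L -> cancel (transfer K L q) (transfer L K q).
Proof.
move=> /fintype.subsetP KL u; apply/ffunP => s; have /andP[sK sq] := valP s.
have Ls : (val s \in L) && (#|val s| == q.+1) by rewrite KL.
pose s' : simplex L q := exist _ (val s) Ls.
by rewrite transferE -[val s]/(val s') coef_val transferE coef_val.
Qed.

Lemma transfer_rel_boundary K L q (c : subvs_of (rel_chain K L q)) :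
  K \subset L ->
  transfer K L q (rel_boundary K L q c) = boundary L q (vsval c).
Proof.
move=> KL; rewrite rel_boundaryE.
have : vsval c \in rel_chain K L q by apply: subvsP.
by rewrite -memv_preim => /memv_imgP[u _ E]; rewrite E (transferK KL).
Qed.

End Simplicial.

(* Main.v *)
Require Import Defs.
From mathcomp Require Import all_boot all_order all_algebra.
From mathcomp Require Import reals.

(** Write d for the boundary of L, E for the extension by zero and P = E^* for
    the restriction.  If u solves the Dirichlet problem for uB, then w := d^* u is
    a relative chain, and <P d c, uB> = <d c, u> = <c, w> for every relative chain
    c, because d c is supported on K.  So w is the image of uB under the adjoint
    of the relative boundary, and both operators send uB to P d w.  For existence,
    put Q := 1 - E P: the chain Q d d^* E uB lies in the image of Q d, which is
    also the image of (Q d)(Q d)^* = Q d d^* Q. *)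

Import GRing.Theory.

Local Open Scope ring_scope.

(** A rank count: definiteness gives [ker (g f) = ker f] and [ker (f g) = ker g], so
    [rk f = rk (g f) <= rk g = rk (f g)], while the image of [f g] lies in that of [f]. *)
Lemma limg_comp_adjoint (R : fieldType) (U W : vectType R) (dU : U -> U -> R)
    (dW : W -> W -> R) (f : 'Hom(U, W)) (g : 'Hom(W, U)) :
  (forall x, dU x 0 = 0) -> (forall x, dU x x = 0 -> x = 0) ->
  (forall y, dW 0 y = 0) -> (forall y, dW y y = 0 -> y = 0) ->
  (forall x y, dW (f x) y = dU x (g y)) ->
  limg (f \o g) = limg f.
Proof.
move=> dU0 dU_def dW0 dW_def fg.
have dim_limg_comp (A B C : vectType R) (h : 'Hom(A, B)) (k : 'Hom(B, C)) :
    (forall x, k (h x) = 0 -> h x = 0) -> \dim (limg (k \o h)) = \dim (limg h).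
  move=> kh0; rewrite limg_comp; apply: limg_dim_eq.
  apply/eqP; rewrite -subv0; apply/subvP => _ /memv_capP[/memv_imgP[x _ ->]].
  by rewrite memv_ker memv0 => /eqP/kh0->.
apply/eqP; rewrite eqEdim limg_comp limgS ?subvf //= -limg_comp.
rewrite dim_limg_comp => [|y fgy]; last by apply: dU_def; rewrite -fg fgy.
rewrite -(dim_limg_comp _ _ _ f g) => [|x gfx]; last first.
  by apply: dW_def; rewrite fg gfx.
by rewrite dimvS // limg_comp limgS ?subvf.
Qed.

Section DirichletToNeumann.
Context {R : realFieldType} {V : finType} (o : {set V} -> bool).
Context (K L : {set {set V}}) (q : nat).
Hypothesis sKL : K \subset L.

Local Notation E := (transfer R K L q).
Local Notation P := (transfer R L K q).
Local Notation d := (boundary R o L q).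
Local Notation "d^*" := (adjoint (@dotc V R L q.+1) (@dotc V R L q) d).

Lemma dotcBr (M : {set {set V}}) (n : nat) (u v w : chain R M n) :
  dotc u (v - w) = dotc u v - dotc u w.
Proof. by rewrite -scaleN1r addrC dotc_scalarr mulN1r addrC. Qed.

Lemma coef_notin (M : {set {set V}}) (u : chain R M q) (s : {set V}) :
  ~~ ((s \in M) && (#|s| == q.+1)) -> coef u s = 0.
Proof. by move=> sM; rewrite /coef insubN. Qed.

Lemma coef_transfer (M N : {set {set V}}) (u : chain R M q) (s : {set V}) :
  coef (transfer R M N q u) s =
  if (s \in N) && (#|s| == q.+1) then coef u s else 0.
Proof.
case: ifPn => [sN|]; last exact: coef_notin.
pose s' : simplex N q := exist _ s sN.
by rewrite -[s]/(val s') coef_val transferE.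
Qed.

(** Summing over all sets of vertices gives chains of [K] and of [L] a common index set, so that [E]
    and [P] can be compared term by term. *)
Lemma dotc_coef (M : {set {set V}}) (u v : chain R M q) :
  dotc u v = \sum_s coef u s * coef v s.
Proof.
rewrite (bigID (fun s => (s \in M) && (#|s| == q.+1))) /= [X in _ + X]big1.
  rewrite addr0 (reindex_omap val (insub : {set V} -> option (simplex M q))).
    by apply: eq_big => [t|t _]; rewrite ?coef_val // (valP t) valK eqxx.
  by move=> s sM; rewrite insubT.
by move=> s sM; rewrite coef_notin ?mul0r.
Qed.

Lemma dotc_transfer (u : chain R K q) (v : chain R L q) :
  dotc (E u) v = dotc u (P v).
Proof.
rewrite !dotc_coef; apply: eq_bigr => s _; rewrite !coef_transfer.
case: ifPn => [_|/coef_notin->]; case: ifPn => [//|/coef_notin->];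
  by rewrite ?mul0r ?mulr0.
Qed.

Lemma transfer_extendE (u : chain R L q) (s : simplex L q) :
  E (P u) s = if val s \in K then u s else 0.
Proof.
rewrite transferE; case: ifPn => sK; last by rewrite coef_notin // (negbTE sK).
have /andP[_ sq] := valP s.
have Ks : (val s \in K) && (#|val s| == q.+1) by rewrite sK.
pose s' : simplex K q := exist _ (val s) Ks.
by rewrite -[val s]/(val s') coef_val transferE coef_val.
Qed.

(** A coordinate-free form of the Dirichlet problem: vanishing on the interior means being fixed by
    the projection [E P]. *)
Lemma dirichlet_solutionP (uB : chain R K q) (u : chain R L q) :
  dirichlet_solution o uB u <->
  E (P (up_laplacian R o L q u)) = up_laplacian R o L q u /\ P u = uB.
Proof.
split=> [[u0 uK]|[u0 <-]].
  split; first by apply/ffunP=> s; rewrite transfer_extendE; case: ifPn => // /u0.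
  (* [E] is injective, so [P u = uB] can be checked on the simplices of [L]. *)
  apply: (can_inj (transferK sKL)); apply/ffunP=> s.
  rewrite transfer_extendE transferE; case: ifPn => [/uK //|sK].
  by rewrite coef_notin // (negbTE sK).
split=> s sK; first by rewrite -u0 transfer_extendE (negbTE sK).
by rewrite -transferE transfer_extendE sK.
Qed.

(** The right-hand side does not involve [u], so this also shows that the value is the same for all
    solutions. *)
Lemma dirichlet_to_neumann_solution (uB : chain R K q) (u : chain R L q) :
  dirichlet_solution o uB u ->
  P (up_laplacian R o L q u) = persistent_up_laplacian R o K L q uB.
Proof.
case/dirichlet_solutionP => uI uK.
have wS : d^* u \in rel_chain R o K L q.
  by rewrite -memv_preim -comp_lfunE -uI memv_img ?memvf.
pose w : subvs_of (rel_chain R o K L q) := Subvs wS.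
rewrite [RHS]comp_lfunE.
suff -> : adjoint (@dot_rel V R o K L q) (@dotc V R K q)
    (rel_boundary R o K L q) uB = w by rewrite rel_boundaryE [in LHS]comp_lfunE.
set z := (LHS).
(* Testing against [c = z - w] and using definiteness gives [z = w]. *)
suff cz (c : subvs_of (rel_chain R o K L q)) :
    dotc (vsval c) (vsval z) = dotc (vsval c) (vsval w).
  apply/subvs_inj/eqP; rewrite -subr_eq0; apply/eqP/dotc_eq0.
  by rewrite dotcBr -linearB cz subrr.
rewrite -[LHS]/(dot_rel c z) -adjoint_rel_boundaryP -adjoint_boundaryP.
by rewrite -transfer_rel_boundary // dotc_transfer uK.
Qed.

Lemma dirichlet_solution_exists (uB : chain R K q) :
  exists u : chain R L q, dirichlet_solution o uB u.
Proof.
pose Q : 'End(chain R L q) := (\1 - (E \o P))%VF.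
have QE x : Q x = x - E (P x).
  by rewrite add_lfunE opp_lfunE id_lfunE comp_lfunE.
(* [Q] is self-adjoint, which makes [d^* Q] the adjoint of [Q d]. *)
have dotQ x y : dotc (Q x) y = dotc x (Q y).
  rewrite !QE dotcBr dotcC dotcBr (dotcC y) (dotcC y) (dotcC x (E _)).
  by rewrite !dotc_transfer (dotcC (P x)).
have imgQ : limg ((Q \o d) \o (d^* \o Q)) = limg (Q \o d)%VF.
  apply: (limg_comp_adjoint _ _ _ (@dotc V R L q.+1) (@dotc V R L q)).
  - by move=> x; apply: big1 => s _; rewrite ffunE mulr0.
  - exact: dotc_eq0.
  - by move=> x; apply: big1 => s _; rewrite ffunE mul0r.
  - exact: dotc_eq0.
  - by move=> x y; rewrite !comp_lfunE dotQ adjoint_boundaryP.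
have : (Q \o d)%VF (d^* (E uB)) \in limg (Q \o d)%VF by rewrite memv_img ?memvf.
rewrite -imgQ => /memv_imgP[v _]; rewrite !comp_lfunE => Qv.
(* Subtracting [Q v] keeps the boundary values, since [P Q = 0], and [v] was chosen so that [Q]
   kills the Laplacian of the difference. *)
exists (E uB - Q v); apply/dirichlet_solutionP; split.
  apply/esym/eqP; rewrite -subr_eq0 -QE comp_lfunE !linearB /= Qv.
  by rewrite subrr.
rewrite linearB /= QE linearB /= !(transferK sKL).
by rewrite subrr subr0.
Qed.

End DirichletToNeumann.

Theorem proposition3p3 (R : realType) (V : finType) (o : {set V} -> bool)
    (K L : {set {set V}}) (q : nat)
    (K_complex : simplicial_complex K) (L_complex : simplicial_complex L)
    (sKL : K \subset L) :
  (forall uB : chain R K q,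
     exists u : chain R L q, dirichlet_solution o uB u) /\
  (forall (uB : chain R K q) (u u' : chain R L q),
     dirichlet_solution o uB u -> dirichlet_solution o uB u' ->
     transfer R L K q (up_laplacian R o L q u) =
     transfer R L K q (up_laplacian R o L q u')) /\
  (forall uB : chain R K q,
     dirichlet_to_neumann o L uB = persistent_up_laplacian R o K L q uB).
Proof.
have ex := @dirichlet_solution_exists R V o K L q sKL.
have DtN := @dirichlet_to_neumann_solution R V o K L q sKL.
split; first exact: ex.
split=> [uB u u' uP u'P|uB]; first by rewrite (DtN uB) ?(DtN uB).
(* By existence, the chain picked by [xget] is a genuine solution and not the default [0]. *)
by apply: DtN; apply: classical_sets.xgetPex; apply: ex.
Qed.
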